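(* Let $\gamma^\star$ be a minimizer over $\gamma\ge 0$ of $\mu\gamma-\lambda V(\gamma,r)$, and let $\textsc{OaRC}$ be the scheduling algorithm that in every period $t$ assigns to each waiting job $j$ the index $c(S_j(t))+V^f(\gamma^\star,S_j(t))$ and serves the $R(t)$ waiting jobs (or all of them, if fewer are waiting) with the highest indices, using a consistent tie-breaking rule. Then $\textsc{OaRC}$ is asymptotically optimal, i.e. $\mathrm{Regret}(N,\textsc{OaRC})/N\to 0$ as $N\to\infty$. More precisely, for every system size $N\ge 1$, $$\mathrm{Regret}(N,\textsc{OaRC})\le c_{\max}\,U(L,\theta,\ln N)\sqrt{N},\qquad U(L,\theta,\ln N)=1610\,\theta^{-2}L^{1.5}\ln^2(55NL).$$
   Context: Job state process: a finite state space $S$ partitioned into levels $S_0,\dots,S_{L-1}$, with $S_0=\{r\}$ (the root). Every $i\in S_\ell$ with $\ell>0$ has a unique parent $\mathrm{pa}(i)\in S_{\ell-1}$. The transition kernel $P$ on $S$ satisfies $P(\mathrm{pa}(i),i)>0$ and $P(k,i)=0$ for $k\ne \mathrm{pa}(i)$. Let $\mathrm{child}(i)=\{k:\mathrm{pa}(k)=i\}$. A state-$i$ job moves to the absorbing empty state $\perp$ (abandons) with probability $1-\sum_{k\in\mathrm{child}(i)}P(i,k)$. Let $\theta=\min_{i\in S}\bigl(1-\sum_{k\in \mathrm{child}(i)}P(i,k)\bigr)$; it is assumed that $\theta>0$. Each state has cost $c(i)>0$, and $c_{\max}=\max_i c(i)$. Queueing system of size $N\ge1$ with $\lambda\in(0,1)$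 and $\mu\in(0,1]$, in discrete periods $t=1,2,\dots$, initially empty. In period $t$: (1) $R(t)\sim\mathrm{Bin}(N,\mu)$ servers become available. (2) The algorithm selects a set of at most $R(t)$ jobs from the current queue; these leave with no further cost. (3) Every remaining waiting job $j$ incurs cost $c(S_j(t))$, where $S_j(t)$ is its state. (4) Every remaining job independently moves to a new state according to $P$; moving to $\perp$ means it leaves. (5) $A(t)\sim\mathrm{Bin}(N,\lambda)$ new jobs arrive, each with state $r$ in period $t+1$. All these random variables are independent. A feasible algorithm decides using only past and current observations (available servers, queue, current and past states, past selections and arrivals) and the model primitives ($N,\lambda,\mu,c,P$), never future information. The long-run average cost of algorithm $\mathcal A$ is $C(N,\mathcal A)=\limsup_{T\to\infty}\frac1T\mathbb E\bigl[\sum_{t=1}^T\sum_{j\text{ waiting and not served in }t}c(S_j(t))\bigr]$. Its regret is $\mathrm{Regret}(N,\mathcal A)=C(N,\mathcal A)-\inf_{\mathcal A'\text{ feasible}}C(N,\mathcal A')$. Cost-to-go: for $\gamma\ge0$, define recursively from the highest level down $$V(\gamma,i)=\min\{\gamma,\;c(i)+V^f(\gamma,i)\},\qquad V^f(\gamma,i)=\sum_{k\in\mathrm{child}(i)}P(i,k)V(\gamma,k)$$ (an empty sum is $0$). A consistent tie-breaking rule is a fixed strict total order on $S$ that ranks states by decreasing index, with jobs served according to their states' positions in this order. *)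

(* Defs.v *)
From HB Require Import structures.
From mathcomp Require Import all_boot all_order all_algebra.
From mathcomp Require Import all_classical all_reals all_analysis.
Set Implicit Arguments.
Unset Strict Implicit.
Unset Printing Implicit Defensive.
Import Order.TTheory GRing.Theory Num.Theory.
Import numFieldNormedType.Exports.
Local Open Scope classical_set_scope.
Local Open Scope ring_scope.

(* Over a finite horizon every random object below takes finitely many values,
   so its law is a finite list of weighted outcomes (outcomes may repeat; their
   weights then add up). *)
Record fdist (R : realType) (T : Type) := FDist {
  fwts : seq (R * T);
  fwts_ge0 : all (fun wx => 0 <= wx.1) fwts;
  fwts_sum1 : \sum_(wx <- fwts) wx.1 = 1 }.

Section FiniteLaws.
Variable R : realType.

Definition expect (T : Type) (d : fdist R T) (f : T -> R) : R :=
  \sum_(wx <- fwts d) wx.1 * f wx.2.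

Section Dirac.
Variables (T : Type) (x : T).
Let wts : seq (R * T) := [:: (1, x)].
Fact dirac_ge0 : all (fun wx => 0 <= wx.1) wts.
Proof. by rewrite /= ler01. Qed.
Fact dirac_sum1 : \sum_(wx <- wts) wx.1 = 1.
Proof. by rewrite big_seq1. Qed.
Definition fret : fdist R T := FDist dirac_ge0 dirac_sum1.
End Dirac.

(* Draw x from d, then an outcome from k x, using fresh randomness. *)
Section Bind.
Variables (T T' : Type) (d : fdist R T) (k : T -> fdist R T').
Let wts : seq (R * T') :=
  flatten [seq [seq (wx.1 * vy.1, vy.2) | vy <- fwts (k wx.2)] | wx <- fwts d].
Fact bind_ge0 : all (fun wx => 0 <= wx.1) wts.
Proof.
rewrite /wts; elim: (fwts d) (fwts_ge0 d) => //= wx s IH /andP[wx0 /IH s0].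
rewrite all_cat s0 andbT all_map.
by apply: sub_all (fwts_ge0 (k wx.2)) => vy /= vy0; rewrite mulr_ge0.
Qed.
Fact bind_sum1 : \sum_(wx <- wts) wx.1 = 1.
Proof.
rewrite /wts big_flatten big_map -(fwts_sum1 d); apply: eq_bigr => wx _.
by rewrite big_map /= -big_distrr /= fwts_sum1 mulr1.
Qed.
Definition fbind : fdist R T' := FDist bind_ge0 bind_sum1.
End Bind.

Lemma expect_ret (T : Type) (x : T) (f : T -> R) : expect (fret x) f = f x.
Proof. by rewrite /expect big_seq1 mul1r. Qed.

Lemma expect_bind (T T' : Type) (d : fdist R T) (k : T -> fdist R T') f :
  expect (fbind d k) f = expect d (fun x => expect (k x) f).
Proof.
rewrite /expect big_flatten big_map; apply: eq_bigr => wx _.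
rewrite big_map big_distrr /=; apply: eq_bigr => vy _.
by rewrite mulrA.
Qed.

Section Binomial.
Variables (n : nat) (p : R) (p01 : 0 <= p <= 1).
Let wts : seq (R * nat) := [seq (binomial_pmf n p k, k) | k <- iota 0 n.+1].
Fact binom_ge0 : all (fun wx => 0 <= wx.1) wts.
Proof.
by apply/allP => _ /mapP[k _ ->] /=; apply: binomial_pmf_ge0.
Qed.
Fact binom_sum1 : \sum_(wx <- wts) wx.1 = 1.
Proof.
rewrite /wts big_map -[iota 0 n.+1]/(index_iota 0 n.+1) big_mkord /=.
rewrite -[RHS](expr1n R n) -[X in X ^+ n](subrK p) exprDn.
apply: eq_bigr => k _; rewrite /binomial_pmf.
by rewrite mulrC.
Qed.
Definition fbinom : fdist R nat := FDist binom_ge0 binom_sum1.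
End Binomial.

Lemma expect_fbinom (n : nat) (p : R) (p01 : 0 <= p <= 1) (f : nat -> R) :
  expect (fbinom n p01) f = \sum_(0 <= k < n.+1) binomial_pmf n p k * f k.
Proof. by rewrite /expect /= -[RHS](big_map (fun k => (binomial_pmf n p k, k))
  xpredT (fun wx => wx.1 * f wx.2)). Qed.

End FiniteLaws.

Local Notation "'draw' x '<-' d ';' e" := (fbind d (fun x => e))
  (at level 200, x name, d at level 100, e at level 200, right associativity).

(* The level sets are S_l = {i | level i = l}, l < nlevels; the root is the only
   state without a parent. *)
Record job_process (R : realType) := JobProcess {
  state : finType;
  root : state;
  nlevels : nat;
  level : state -> nat;
  parent : state -> option state;
  trans : state -> state -> R;
  cost : state -> R;
  level_lt : forall i, (level i < nlevels)%N;
  level0 : forall i, level i = 0%N <-> i = root;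
  parent_root : parent root = None;
  parent_level : forall i, (0 < level i)%N ->
    exists2 k, parent i = Some k & (level k).+1 = level i;
  trans_parent : forall i k, parent i = Some k -> 0 < trans k i;
  trans_nparent : forall i k, parent i <> Some k -> trans k i = 0;
  cost_gt0 : forall i, 0 < cost i }.

Section JobProcess.
Variables (R : realType) (J : job_process R).

Definition child (i : state J) : {set state J} := [set k | parent k == Some i].

Definition abandon (i : state J) : R := 1 - \sum_(k in child i) trans i k.

(* The unit supplied to the iterated min (max) is itself one of its arguments,
   so these are the minimum and the maximum over all states. *)
Definition theta : R := \big[Num.min/abandon (root J)]_(i : state J) abandon i.

Definition cost_max : R := \big[Num.max/cost (root J)]_(i : state J) cost i.

(* Recursion on the number n of levels still to be explored. *)
Fixpoint cost_to_go (n : nat) (g : R) (i : state J) : R :=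
  if n is n'.+1 then
    Num.min g (cost i + \sum_(k in child i) trans i k * cost_to_go n' g k)
  else 0.

Definition V (g : R) (i : state J) : R := cost_to_go (nlevels J) g i.

Definition Vf (g : R) (i : state J) : R := \sum_(k in child i) trans i k * V g k.

Definition oarc_index (g : R) (i : state J) : R := cost i + Vf g i.

Lemma level_child (i k : state J) : k \in child i -> level k = (level i).+1.
Proof.
rewrite inE => /eqP ki; have [k0|kr] := posnP (level k).
  by move/level0: k0 ki => ->; rewrite parent_root.
by have [i' ] := parent_level kr; rewrite ki => -[<-].
Qed.

Lemma cost_to_go_fuel n m (g : R) i :
  (nlevels J <= level i + n)%N -> (nlevels J <= level i + m)%N ->
  cost_to_go n g i = cost_to_go m g i.
Proof.
have noti : ~ (nlevels J <= level i + 0)%N.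
  by rewrite addn0 leqNgt level_lt.
elim: n m i noti => [|n IH] [|m] i noti hn hm //=.
congr (Num.min _ (_ + _)); apply: eq_bigr => k ki; congr (_ * _).
have lk := level_child ki.
apply: IH; [|by rewrite lk addSnnS..].
by rewrite addn0 leqNgt level_lt.
Qed.

Lemma VE (g : R) i : V g i = Num.min g (cost i + Vf g i).
Proof.
rewrite {1}/V (@cost_to_go_fuel _ (nlevels J).+1) //= ?leq_addl //.
by rewrite addnS ltnW // ltnS leq_addl.
Qed.

End JobProcess.

Arguments oarc_index {R J} g i.

Record model (R : realType) := Model {
  process :> job_process R;
  lambda : R;
  mu : R;
  lambda01 : 0 < lambda < 1;
  mu01 : 0 < mu <= 1;
  theta_gt0 : 0 < theta process }.

Section Queue.
Variables (R : realType) (M : model R).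

Local Notation S := (state M).

(* (t, k) is the k-th arrival of the t-th period, both counted from 0. *)
Definition job : Type := (nat * nat)%type.

Definition queue : Type := seq (job * S).

(* A set of jobs of the queue q is encoded as a bit mask m along q. *)
Definition unserved (m : bitseq) (q : queue) : queue := mask (map negb m) q.

Record period := Period {
  servers : nat;
  waiting : queue;
  served : bitseq;
  arrivals : nat }.

(* Past periods, most recent first, and the current queue. *)
Definition history : Type := (seq period * queue)%type.

(* The decision may depend on everything observed so far, including the current
   number of available servers. *)
Definition algorithm : Type := history -> nat -> bitseq.

Definition feasible (alg : algorithm) : Prop :=
  forall (h : history) (n : nat),
    size (alg h n) = size h.2 /\ (count id (alg h n) <= n)%N.

Fact lambda_prob : 0 <= lambda M <= 1.
Proof. by have /andP[/ltW-> /ltW->] := lambda01 M. Qed.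

Fact mu_prob : 0 <= mu M <= 1.
Proof. by have /andP[/ltW-> ->] := mu01 M. Qed.

Section Move.
Variable i : S.
(* None is the empty state. *)
Let wts : seq (R * option S) :=
  (abandon i, None) :: [seq (trans i k, Some k) | k <- enum (child i)].
Fact move_ge0 : all (fun wx => 0 <= wx.1) wts.
Proof.
apply/allP => wx; rewrite inE => /orP[/eqP-> /=|/mapP[k]].
  apply/ltW; apply: lt_le_trans (theta_gt0 M) _.
  exact: bigmin_le_cond.
rewrite mem_enum inE => /eqP ki -> /=.
exact/ltW/trans_parent.
Qed.
Fact move_sum1 : \sum_(wx <- wts) wx.1 = 1.
Proof. by rewrite /wts big_cons big_map big_enum /= /abandon subrK. Qed.
Definition move : fdist R (option S) := FDist move_ge0 move_sum1.
End Move.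

Lemma expect_move (i : S) (f : option S -> R) :
  expect (move i) f =
  abandon i * f None + \sum_(k in child i) trans i k * f (Some k).
Proof. by rewrite /expect /= big_cons big_map big_enum. Qed.

Fixpoint move_all (q : queue) : fdist R queue :=
  if q is x :: q' then
    draw o <- move x.2;
    draw q'' <- move_all q';
    fret R (if o is Some k then (x.1, k) :: q'' else q'')
  else fret R [::].

Definition new_jobs (t a : nat) : queue := [seq ((t, k), root M) | k <- iota 0 a].

Definition one_period (N : nat) (alg : algorithm) (h : history) :
    fdist R history :=
  draw n <- fbinom N mu_prob;
  draw q <- move_all (unserved (alg h n) h.2);
  draw a <- fbinom N lambda_prob;
  fret R (Period n h.2 (alg h n) a :: h.1, q ++ new_jobs (size h.1) a).

Fixpoint law (N : nat) (alg : algorithm) (T : nat) : fdist R history :=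
  if T is T'.+1 then draw h <- law N alg T'; one_period N alg h
  else fret R ([::], [::]).

Definition period_cost (p : period) : R :=
  \sum_(x <- unserved (served p) (waiting p)) cost x.2.

Definition total_cost (h : history) : R := \sum_(p <- h.1) period_cost p.

Definition average_cost (N : nat) (alg : algorithm) : \bar R :=
  limn_esup (fun T => (T%:R^-1 * expect (law N alg T) total_cost)%:E).

Definition optimal_cost (N : nat) : \bar R :=
  ereal_inf [set average_cost N alg | alg in feasible].

Definition regret (N : nat) (alg : algorithm) : \bar R :=
  (average_cost N alg - optimal_cost N)%E.

Definition dual_minimizer (g : R) : Prop :=
  0 <= g /\ forall g', 0 <= g' ->
    mu M * g - lambda M * V g (root M) <= mu M * g' - lambda M * V g' (root M).

(* before i k: state i precedes state k in the service order. *)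
Definition tie_breaking (g : R) (before : rel S) : Prop :=
  [/\ irreflexive before, transitive before,
      (forall i k, i != k -> before i k || before k i)
    & (forall i k, oarc_index g k < oarc_index g i -> before i k)].

(* Among jobs in the same state the choice is left open. *)
Definition is_OaRC (before : rel S) (alg : algorithm) : Prop :=
  forall (h : history) (n : nat),
    [/\ size (alg h n) = size h.2,
        count id (alg h n) = minn n (size h.2)
      & forall x y, x \in mask (alg h n) h.2 -> y \in unserved (alg h n) h.2 ->
          ~~ before y.2 x.2].

Lemma OaRC_feasible before alg : is_OaRC before alg -> feasible alg.
Proof. by move=> O h n; have [-> -> _] := O h n; rewrite geq_minl. Qed.

End Queue.

Arguments feasible {R M} alg.

Definition U (R : realType) (L : nat) (th : R) (N : nat) : R :=
  1610 * th ^- 2 * L%:R `^ (3 / 2) * ln (55 * N * L)%:R ^+ 2.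

(* Main.v *)
(* Price a service at the dual minimiser g and take V(g, state), summed over
   the queue, as potential. For every feasible algorithm the expected cost of a
   period plus the expected increase of the potential equals
   N (lambda V(g, r) - mu g) plus a nonnegative duality gap, which gives weak
   duality; so the regret of OaRC is at most its average gap. That gap is
   bounded by the mean number of jobs of index > g left unserved (excess), plus
   the mean number of servers not used on jobs of index >= g (shortage), both
   weighted by at most c_max / theta.

   Let A be {index > g} or {index >= g}. The first-order conditions at g say
   that, if no job were served outside A, first visits to A would occur at mean
   rate at most mu N, respectively at least mu N. The expected number of first
   visits to A in a given period, with served jobs counted as if they had
   stayed, is a martingale; by the law of total variance its variance is at
   most L N, since a job lives for at most L periods. So it is off its mean by
   O(sqrt (L N)) only.

   The real number of A-jobs differs from this in two ways: an unserved A-job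
   may visit A again, and a job served outside A (which takes a shortage) is
   missed in A later. Either event has probability at most 1 - theta, so
   summing over time yields total <= noise + (1 - theta) total, i.e.
   total <= noise / theta. *)
Require Import Defs.
From HB Require Import structures.
From mathcomp Require Import all_boot all_order all_algebra.
From mathcomp Require Import ring lra.
From mathcomp Require Import all_classical all_reals all_analysis.
Set Implicit Arguments.
Unset Strict Implicit.
Unset Printing Implicit Defensive.
Import Order.TTheory GRing.Theory Num.Theory.
Import numFieldNormedType.Exports.
Local Open Scope classical_set_scope.
Local Open Scope ring_scope.

(* The root of a job tree, not the roots of a polynomial. *)
Local Notation root := Defs.root.

Lemma mulr_natl_sum (R : pzSemiRingType) n (c : R) : n%:R * c = \sum_(i < n) c.
Proof. by rewrite sumr_const card_ord mulr_natl. Qed.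

Section Moments.
Variable R : realType.

Section OneLaw.
Variables (T : Type) (d : fdist R T).
Implicit Types f g : T -> R.

Lemma expect_cst (c : R) : expect d (fun=> c) = c.
Proof. by rewrite /expect -big_distrl /= fwts_sum1 mul1r. Qed.

Lemma eq_expect f g : f =1 g -> expect d f = expect d g.
Proof. by move=> fg; apply: eq_bigr => wx _; rewrite fg. Qed.

Lemma expectD f g : expect d (fun x => f x + g x) = expect d f + expect d g.
Proof.
by rewrite /expect -big_split; apply: eq_bigr => wx _; rewrite mulrDr.
Qed.

Lemma expectDr (c : R) f : expect d (fun x => f x + c) = expect d f + c.
Proof. by rewrite expectD expect_cst. Qed.

Lemma expectZ (c : R) f : expect d (fun x => c * f x) = c * expect d f.
Proof.
by rewrite /expect big_distrr; apply: eq_bigr => wx _; rewrite /= mulrCA.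
Qed.

Lemma expectB f g : expect d (fun x => f x - g x) = expect d f - expect d g.
Proof.
rewrite expectD -mulN1r -expectZ; congr (_ + _).
by apply: eq_expect => x; rewrite mulN1r.
Qed.

Lemma le_expect f g : (forall x, f x <= g x) -> expect d f <= expect d g.
Proof.
move=> fg; rewrite /expect; elim: (fwts d) (fwts_ge0 d) => [|wx s IH] /=.
  by rewrite !big_nil.
by case/andP=> w0 s0; rewrite !big_cons lerD ?IH// ler_wpM2l.
Qed.

Lemma expect_le (c : R) f : (forall x, f x <= c) -> expect d f <= c.
Proof. by move=> /le_expect; rewrite expect_cst. Qed.

Lemma expect_ge (c : R) f : (forall x, c <= f x) -> c <= expect d f.
Proof. by move=> /le_expect; rewrite expect_cst. Qed.

Definition var f : R := expect d (fun x => (f x - expect d f) ^+ 2).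

Lemma var_ge0 f : 0 <= var f.
Proof. by apply: expect_ge => x; exact: sqr_ge0. Qed.

Lemma eq_var f g : f =1 g -> var f = var g.
Proof. by move=> fg; apply: eq_expect => x; rewrite (eq_expect fg) fg. Qed.

Lemma varE f : var f = expect d (fun x => f x ^+ 2) - expect d f ^+ 2.
Proof.
set m := expect d f.
rewrite /var -/m (@eq_expect _ (fun x => f x ^+ 2 - 2 * m * f x + m ^+ 2)).
  by rewrite expectDr expectB expectZ -/m; ring.
by move=> x; ring.
Qed.

Lemma var_cst (c : R) : var (fun=> c) = 0.
Proof. by rewrite varE !expect_cst subrr. Qed.

Lemma varDr (c : R) f : var (fun x => f x + c) = var f.
Proof.
by apply: eq_expect => x; rewrite expectDr opprD addrACA subrr addr0.
Qed.

Lemma varZ (c : R) f : var (fun x => c * f x) = c ^+ 2 * var f.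
Proof.
by rewrite /var -expectZ; apply: eq_expect => x; rewrite expectZ -mulrBr exprMn.
Qed.

Lemma var_le_expect f : (forall x, 0 <= f x <= 1) -> var f <= expect d f.
Proof.
move=> f01; rewrite varE lerBlDr; apply: ler_wpDr; first exact: sqr_ge0.
by apply: le_expect => x; have /andP[f0 f1] := f01 x; rewrite expr2 ler_piMl.
Qed.

Lemma expect_dist_mean_le f :
  expect d (fun x => `|f x - expect d f|) <= Num.sqrt (var f).
Proof.
set dist := fun x => `|f x - expect d f|.
have dist0 : 0 <= expect d dist by apply: expect_ge => x; exact: normr_ge0.
rewrite -(ger0_norm dist0) -sqrtr_sqr ler_wsqrtr//.
have -> : var f = expect d (fun x => dist x ^+ 2).
  by apply: eq_expect => x; rewrite real_normK ?num_real.
by rewrite -subr_ge0 -varE var_ge0.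
Qed.

End OneLaw.

Section Composition.
Variables T T' : Type.

Lemma var_ret (x : T) (f : T -> R) : var (fret R x) f = 0.
Proof. by rewrite varE !expect_ret subrr. Qed.

Lemma var_bind (d : fdist R T) (k : T -> fdist R T') f :
  var (fbind d k) f =
  expect d (fun x => var (k x) f) + var d (fun x => expect (k x) f).
Proof.
rewrite !varE !expect_bind addrCA addrA; congr (_ - _); rewrite addrC -expectD.
by apply: eq_expect => x; rewrite varE subrK.
Qed.

Lemma expect_map (d : fdist R T) (h : T -> T') (f : T' -> R) :
  expect (fbind d (fun x => fret R (h x))) f = expect d (f \o h).
Proof. by rewrite expect_bind; apply: eq_expect => x; exact: expect_ret. Qed.

Lemma var_map (d : fdist R T) (h : T -> T') (f : T' -> R) :
  var (fbind d (fun x => fret R (h x))) f = var d (f \o h).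
Proof. by rewrite !varE !expect_map. Qed.

End Composition.

Section Binomial.
Variables (p : R) (p01 : 0 <= p <= 1).

Lemma expect_fbinom0 (f : nat -> R) : expect (fbinom 0 p01) f = f 0%N.
Proof.
rewrite expect_fbinom big_nat1 /binomial_pmf !expr0 mulr1 bin0 mulr1n.
by rewrite mul1r.
Qed.

Lemma expect_fbinomS (n : nat) (f : nat -> R) :
  expect (fbinom n.+1 p01) f =
  (1 - p) * expect (fbinom n p01) f + p * expect (fbinom n p01) (f \o succn).
Proof.
rewrite !expect_fbinom !big_mkord !big_distrr /=.
rewrite big_ord_recl [X in _ = X + _]big_ord_recl [X in _ + X = _]big_ord_recr.
rewrite [X in _ = _ + X]big_ord_recr /= -!addrA; congr (_ + _).
  by rewrite /binomial_pmf !bin0 !expr0 !subn0 exprS /unstable.onem; ring.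
rewrite addrA -big_split /=; congr (_ + _); last first.
  by rewrite /binomial_pmf !binn !subnn exprS; ring.
apply: eq_bigr => k _; rewrite /binomial_pmf /bump /= !add1n.
rewrite subSS binS mulrnDr exprS /unstable.onem.
by rewrite -(subnSK (ltn_ord k)) exprS; ring.
Qed.

Lemma expect_fbinom_mean (n : nat) :
  expect (fbinom n p01) (fun k => k%:R) = p * n%:R.
Proof.
elim: n => [|n IH]; first by rewrite expect_fbinom0 mulr0.
rewrite expect_fbinomS [X in _ + p * X](@eq_expect _ _ _ (fun k => k%:R + 1)).
  by rewrite expectDr IH -natr1; ring.
by move=> k /=; rewrite natr1.
Qed.

Lemma expect_fbinom_sqr (n : nat) :
  expect (fbinom n p01) (fun k => k%:R ^+ 2) =
  (p * n%:R) ^+ 2 + p * (1 - p) * n%:R.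
Proof.
elim: n => [|n IH]; first by rewrite expect_fbinom0 !mulr0 expr0n addr0.
rewrite expect_fbinomS.
rewrite [X in _ + p * X](@eq_expect _ _ _ (fun k => k%:R ^+ 2 + 2 * k%:R + 1)).
  by rewrite expectDr expectD expectZ IH expect_fbinom_mean -natr1; ring.
by move=> k /=; rewrite -natr1; ring.
Qed.

Lemma var_fbinom (n : nat) :
  var (fbinom n p01) (fun k => k%:R) = p * (1 - p) * n%:R.
Proof.
by rewrite varE expect_fbinom_sqr expect_fbinom_mean addrAC subrr add0r.
Qed.

End Binomial.
End Moments.

Section JobTree.
Variables (R : realType) (J : job_process R).
Implicit Types (i k : state J) (f : state J -> R).

Lemma level_root : level (root J) = 0%N.
Proof. exact/level0. Qed.

Lemma nlevels_gt0 : (0 < nlevels J)%N.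
Proof. by apply: leq_trans (level_lt (root J)); rewrite ltnS. Qed.

Lemma bottom_up_ind (P : state J -> Prop) :
  (forall i, {in child i, forall k, P k} -> P i) -> forall i, P i.
Proof.
move=> IH i; have [n] := ubnP (nlevels J - level i); elim: n i => // n IHn i.
rewrite ltnS => le_n; apply: IH => k /level_child lk; apply: IHn.
by apply: leq_trans le_n; rewrite lk subnS prednK// subn_gt0 level_lt.
Qed.

Lemma trans_ge0 i k : k \in child i -> 0 <= trans i k.
Proof. by rewrite inE => /eqP ki; exact/ltW/trans_parent. Qed.

Lemma theta_le i : theta J <= abandon i.
Proof. exact: bigmin_le_cond. Qed.

Lemma theta_le1 : theta J <= 1.
Proof.
rewrite (le_trans (theta_le (root J)))// /abandon gerBl.
by apply: sumr_ge0 => k; exact: trans_ge0.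
Qed.

Lemma cost_le_max i : cost i <= cost_max J.
Proof. exact: le_bigmax. Qed.

Lemma cost_max_ge0 : 0 <= cost_max J.
Proof. exact: le_trans (ltW (cost_gt0 (root J))) (cost_le_max _). Qed.

(* Abandoned jobs, in the empty state, count for 0. *)
Definition next f i : R := \sum_(k in child i) trans i k * f k.

Lemma eq_next f f' i :
  {in child i, forall k, f k = f' k} -> next f i = next f' i.
Proof. by move=> ff'; apply: eq_bigr => k ki; rewrite ff'. Qed.

Lemma le_next f f' i :
  {in child i, forall k, f k <= f' k} -> next f i <= next f' i.
Proof.
by move=> ff'; apply: ler_sum => k ki; rewrite ler_wpM2l ?trans_ge0 ?ff'.
Qed.

Lemma next0 f i : {in child i, forall k, f k = 0} -> next f i = 0.
Proof. by move=> f0; apply: big1 => k ki; rewrite f0 ?mulr0. Qed.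

Lemma nextD f f' i : next (fun k => f k + f' k) i = next f i + next f' i.
Proof. by rewrite /next -big_split; apply: eq_bigr => k _; rewrite mulrDr. Qed.

Lemma nextZ (c : R) f i : next (fun k => c * f k) i = c * next f i.
Proof.
by rewrite /next big_distrr; apply: eq_bigr => k _; rewrite /= mulrCA.
Qed.

Lemma next_sum n (h : nat -> state J -> R) i :
  next (fun k => \sum_(m < n) h m k) i = \sum_(m < n) next (h m) i.
Proof. by rewrite exchange_big; apply: eq_bigr => k _; rewrite big_distrr. Qed.

Lemma next_ge0 f i : {in child i, forall k, 0 <= f k} -> 0 <= next f i.
Proof.
by move=> f0; apply: sumr_ge0 => k ki; rewrite mulr_ge0 ?trans_ge0 ?f0.
Qed.

Lemma next_le (c : R) f i : 0 <= c -> {in child i, forall k, f k <= c} ->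
  next f i <= (1 - theta J) * c.
Proof.
move=> c0 fc; apply: (@le_trans _ _ (next (fun=> c) i)); first exact: le_next.
rewrite /next -big_distrl ler_wpM2r//=.
by rewrite lerBrDl -lerBrDr theta_le.
Qed.

End JobTree.

Section Hitting.
Variables (R : realType) (J : job_process R) (A : pred (state J)).
Hypothesis theta_ge0 : 0 <= theta J.
Implicit Types (i k : state J) (n m : nat).

(* Probability that a job in state [i] and never served is in [A] [n] periods
   later, and not before. *)
Fixpoint hit_at n i : R :=
  if n is n'.+1 then if A i then 0 else next (hit_at n') i else (A i)%:R.

Definition hit i : R := \sum_(n < nlevels J) hit_at n i.

Lemma hit_at_ge0 n i : 0 <= hit_at n i.
Proof.
elim: n i => [|n IH] i /=; first by case: (A i).
by case: ifP => // _; apply: next_ge0.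
Qed.

Lemma hit_at_late n i : (nlevels J <= level i + n)%N -> hit_at n i = 0.
Proof.
elim: n i => /= [|n IH] i; first by rewrite addn0 leqNgt level_lt.
move=> late; case: ifP => // _.
by apply: next0 => k /level_child lk; rewrite IH// lk addSnnS.
Qed.

Lemma sum_hit_at n i : (nlevels J <= n)%N -> \sum_(m < n) hit_at m i = hit i.
Proof.
move=> /subnKC <-; rewrite big_split_ord /= [X in _ + X]big1 ?addr0// => m _.
by rewrite hit_at_late// addnCA leq_addr.
Qed.

Lemma sum_hit_at_le n i : \sum_(m < n) hit_at m i <= hit i.
Proof.
rewrite -(sum_hit_at i (leq_addl n (nlevels J))) big_split_ord /= lerDl.
by apply: sumr_ge0 => m _; exact: hit_at_ge0.
Qed.

Lemma hit_ge0 i : 0 <= hit i.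
Proof. by apply: sumr_ge0 => n _; exact: hit_at_ge0. Qed.

Lemma hitE i : hit i = if A i then 1 else next hit i.
Proof.
rewrite -(sum_hit_at i (leqnSn _)) big_ord_recl /=; case: ifP => Ai.
  by rewrite big1 ?addr0.
by rewrite add0r -next_sum.
Qed.

Lemma hit_le1 i : hit i <= 1.
Proof.
elim/bottom_up_ind: i => i IH; rewrite hitE; case: ifP => // _.
by apply: le_trans (next_le ler01 IH) _; rewrite mulr1 gerBl.
Qed.

Lemma next_hit_ge0 i : 0 <= next hit i.
Proof. by apply: next_ge0 => k _; exact: hit_ge0. Qed.

Lemma next_hit_le i : next hit i <= 1 - theta J.
Proof. by rewrite -[leRHS]mulr1; apply: next_le => // k _; exact: hit_le1. Qed.

Fixpoint fresh_within n i : bool :=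
  if n is n'.+1 then
    if parent i is Some k then ~~ A k && fresh_within n' k else true
  else true.

(* No strict ancestor of [i] lies in [A]: since the states form a tree, a job
   in state [i] then visits [A] now for the first time, or has not visited it
   yet. *)
Definition fresh i : bool := fresh_within (level i) i.

Lemma fresh_root : fresh (root J).
Proof. by rewrite /fresh level_root. Qed.

Lemma fresh_child i k : k \in child i -> fresh k = ~~ A i && fresh i.
Proof.
move=> ki; rewrite /fresh (level_child ki) /=.
by move: ki; rewrite inE => /eqP ->.
Qed.

Definition first_hit n i : R := if fresh i then hit_at n i else 0.

Lemma first_hit0 i : first_hit 0 i = (A i && fresh i)%:R.
Proof. by rewrite /first_hit andbC; case: (fresh i). Qed.

Lemma first_hitS n i : first_hit n.+1 i = next (first_hit n) i.
Proof.
have children k : k \in child i ->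
    first_hit n k = if ~~ A i && fresh i then hit_at n k else 0.
  by rewrite /first_hit => /fresh_child ->.
rewrite (eq_next children) {1}/first_hit /=.
by case: (A i); case: (fresh i) => //=; rewrite next0.
Qed.

Lemma first_hit_ge0 n i : 0 <= first_hit n i.
Proof. by rewrite /first_hit; case: ifP => // _; exact: hit_at_ge0. Qed.

Lemma first_hit_late n i : (nlevels J <= level i + n)%N -> first_hit n i = 0.
Proof. by move=> late; rewrite /first_hit hit_at_late// if_same. Qed.

Lemma first_hit_le1 n i : first_hit n i <= 1.
Proof.
rewrite /first_hit; case: ifP => // _; apply: le_trans (hit_le1 i).
apply: le_trans (sum_hit_at_le n.+1 i); rewrite big_ord_recr /= lerDr.
by apply: sumr_ge0 => m _; exact: hit_at_ge0.
Qed.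

Definition later_hits n i : R := \sum_(m < nlevels J) first_hit (n + m) i.

Lemma later_hits_ge0 n i : 0 <= later_hits n i.
Proof. by apply: sumr_ge0 => m _; exact: first_hit_ge0. Qed.

Lemma later_hits_rec n i : later_hits n i = first_hit n i + later_hits n.+1 i.
Proof.
rewrite /later_hits -(prednK (nlevels_gt0 J)) big_ord_recl addn0; congr (_ + _).
rewrite big_ord_recr /= first_hit_late ?addr0; last first.
  by rewrite addSnnS prednK ?nlevels_gt0// addnA leq_addl.
by apply: eq_bigr => m _; rewrite /bump add1n addSnnS.
Qed.

Lemma later_hits1_le i : later_hits 1 i <= (1 - theta J) * (~~ A i)%:R.
Proof.
case: (boolP (A i)) => Ai /=.
  rewrite mulr0 /later_hits big1// => m _.
  by rewrite /first_hit add1n /= Ai if_same.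
have -> : later_hits 1 i = next (fun k => \sum_(m < nlevels J) first_hit m k) i.
  by rewrite next_sum; apply: eq_bigr => m _; rewrite add1n first_hitS.
apply: next_le => // k _; rewrite /first_hit.
by case: (fresh k); [exact: hit_le1|rewrite big1].
Qed.

(* Probability that a job in state [i] and never served visits [A] from now on,
   having visited it in the past. *)
Definition revisit i : R := if fresh i then 0 else hit i.

Lemma revisit_ge0 i : 0 <= revisit i.
Proof. by rewrite /revisit; case: ifP => // _; exact: hit_ge0. Qed.

Lemma revisit_split i :
  revisit i = (A i && ~~ fresh i)%:R + (~~ A i)%:R * revisit i.
Proof.
rewrite /revisit hitE; case: (A i); case: (fresh i);
  by rewrite /= ?mul0r ?mul1r ?addr0 ?add0r.
Qed.

Lemma next_revisit_le i :
  next revisit i <= (1 - theta J) * (A i)%:R + (~~ A i)%:R * revisit i.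
Proof.
case: (boolP (A i)) => Ai /=.
  rewrite mul0r addr0; apply: next_le => // k _.
  by rewrite /revisit; case: ifP => // _; exact: hit_le1.
rewrite mulr0 mul1r add0r {2}/revisit; case: ifPn => fi.
  by rewrite next0// => k /fresh_child ki; rewrite /revisit ki Ai fi.
rewrite hitE (negbTE Ai); apply: le_next => k /fresh_child ki.
by rewrite /revisit ki (negbTE fi) andbF.
Qed.

End Hitting.

Section CostToGo.
Variables (R : realType) (M : model R).
Implicit Types (g e : R) (i k : state M) (A : pred (state M)).

Lemma theta_ge0 : 0 <= theta M.
Proof. exact/ltW/theta_gt0. Qed.

Lemma oarc_indexE g i : oarc_index g i = cost i + next (V g) i.
Proof. by []. Qed.

Lemma V_min_index g i : V g i = Num.min g (oarc_index g i).
Proof. exact: VE. Qed.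

Lemma V_le_price g i : V g i <= g.
Proof. by rewrite V_min_index ge_min lexx. Qed.

Lemma V_le_index g i : V g i <= oarc_index g i.
Proof. by rewrite V_min_index ge_min lexx orbT. Qed.

Lemma V_ge0 g i : 0 <= g -> 0 <= V g i.
Proof.
move=> g0; elim/bottom_up_ind: i => i IH; rewrite VE le_min g0 addr_ge0//.
  exact/ltW/cost_gt0.
exact: next_ge0.
Qed.

Definition index_bound : R := cost_max M / theta M.

Lemma index_bound_ge0 : 0 <= index_bound.
Proof. by rewrite divr_ge0 ?cost_max_ge0 ?theta_ge0. Qed.

Lemma oarc_index_le g i : oarc_index g i <= index_bound.
Proof.
elim/bottom_up_ind: i => i IH.
have -> : index_bound = cost_max M + (1 - theta M) * index_bound.
  by rewrite /index_bound; field; rewrite gt_eqF ?theta_gt0.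
rewrite lerD ?cost_le_max// next_le ?index_bound_ge0// => k /IH.
exact/le_trans/V_le_index.
Qed.

Definition above g i : bool := g < oarc_index g i.
Definition at_least g i : bool := g <= oarc_index g i.

(* No index, computed at price [g], lies strictly between [g] and [g + e], and
   [A] is the set of states whose index is above that interval. *)
Definition separates A g e : Prop := forall i,
  if A i then g + Num.max 0 e <= oarc_index g i
  else oarc_index g i <= g + Num.min 0 e.

Lemma exists_separates g : exists2 e, 0 < e & forall e', 0 <= e' <= e ->
  separates (above g) g e' /\ separates (at_least g) g (- e').
Proof.
pose gap i := `|oarc_index g i - g|.
exists (\big[Num.min/1]_(i | 0 < gap i) gap i); first exact: lt_bigmin.
move=> e' /andP[e'0 e'gap].
have {}e'gap i : oarc_index g i != g -> e' <= gap i.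
  move=> ig; apply: le_trans e'gap _; apply: bigmin_le_cond.
  by rewrite normr_gt0 subr_eq0.
split=> i.
  rewrite /above; case: ltP => [gi|]; last by rewrite min_l// addr0.
  rewrite max_r// -lerBrDl; have := e'gap i; rewrite gt_eqF// => /(_ isT).
  by rewrite /gap ger0_norm// subr_ge0 ltW.
rewrite /at_least; case: leP => [|ig]; first by rewrite max_l ?oppr_le0// addr0.
rewrite min_r ?oppr_le0// lerBrDr -lerBrDl; have := e'gap i.
by rewrite lt_eqF// => /(_ isT); rewrite /gap distrC ger0_norm// subr_ge0 ltW.
Qed.

(* The one-sided slopes at [g] of the concave function [V ^~ i] are the hitting
   probabilities of [at_least g] and [above g]; this half of the fact suffices. *)
Lemma V_shift_ge A g e i :
  separates A g e -> V g i + e * hit A i <= V (g + e) i.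
Proof.
move=> sep; elim/bottom_up_ind: i => i IH.
set h := next (hit A) i.
have h0 : 0 <= h by exact: next_hit_ge0.
have h1 : h <= 1.
  by apply: le_trans (next_hit_le A theta_ge0 i) _; rewrite gerBl theta_ge0.
have index_shift : oarc_index g i + e * h <= oarc_index (g + e) i.
  by rewrite !oarc_indexE -addrA lerD2l -nextZ -nextD le_next.
rewrite [leRHS]V_min_index le_min hitE -/h; have := sep i.
case: (A i) => index_i.
  have /andP[] : (g <= oarc_index g i) && (g + e <= oarc_index g i + e * h).
    by move: index_i; case: (leP 0 e) => e0 ?; apply/andP; split; nra.
  by move=> gi gei; rewrite V_min_index min_l// mulr1 lexx (le_trans gei).
have /andP[] : (oarc_index g i <= g) && (oarc_index g i + e * h <= g + e).
  by move: index_i; case: (leP 0 e) => e0 ?; apply/andP; split; nra.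
by move=> ig ige; rewrite V_min_index min_r// ige index_shift.
Qed.

Section FirstOrderConditions.
Variable g : R.
Hypothesis g_opt : dual_minimizer M g.

Lemma dual_minimizer_shift A e : separates A g e -> 0 <= g + e ->
  lambda M * (e * hit A (root M)) <= mu M * e.
Proof.
have [_ opt] := g_opt; have /andP[lam0 _] := lambda_prob M.
move=> /(V_shift_ge (root M)) /(ler_wpM2l lam0) shift /opt; lra.
Qed.

Lemma hit_above_le : lambda M * hit (above g) (root M) <= mu M.
Proof.
have [e e0 /(_ e)] := exists_separates g; rewrite lexx (ltW e0) => -[]// sep _.
have [g0 _] := g_opt; have := dual_minimizer_shift sep (addr_ge0 g0 (ltW e0)).
by rewrite mulrCA [leRHS]mulrC ler_pM2l.
Qed.

Lemma hit_at_least_ge : 0 < g -> mu M <= lambda M * hit (at_least g) (root M).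
Proof.
move=> g0; have [e e0 sep] := exists_separates g.
have eg0 : 0 < Num.min e g by rewrite lt_min e0.
have [] := sep (Num.min e g); first by rewrite ge_min lexx ltW.
move=> _ /dual_minimizer_shift; rewrite subr_ge0 ge_min lexx orbT => /(_ isT).
by rewrite mulrCA [leRHS]mulrC !mulNr lerN2 ler_pM2l.
Qed.

Lemma dual_minimizer_le : g <= index_bound.
Proof.
have [g0 _] := g_opt; have /andP[mu0 _] := mu01 M.
have [->|gn0] := eqVneq g 0; first exact: index_bound_ge0.
have gt0 : 0 < g by rewrite lt_neqAle eq_sym gn0.
case: (pickP (at_least g)) => [i gi|none].
  exact: le_trans gi (oarc_index_le _ _).
have hit0 : hit (at_least g) (root M) = 0.
  elim/bottom_up_ind: (root M) => i IH.
  by rewrite hitE none; exact: next0.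
by have := lt_le_trans mu0 (hit_at_least_ge gt0); rewrite hit0 mulr0 ltxx.
Qed.

End FirstOrderConditions.
End CostToGo.

Section QueueSums.
Variables (R : realType) (M : model R).
Implicit Types (q : queue M) (f : state M -> R) (m : bitseq).

Definition qsum f q : R := \sum_(x <- q) f x.2.

Lemma qsum_nil f : qsum f [::] = 0.
Proof. exact: big_nil. Qed.

Lemma qsum_cons f x q : qsum f (x :: q) = f x.2 + qsum f q.
Proof. exact: big_cons. Qed.

Lemma eq_qsum f f' q : f =1 f' -> qsum f q = qsum f' q.
Proof. by move=> ff'; apply: eq_bigr => x _; rewrite ff'. Qed.

Lemma le_qsum f f' q : (forall i, f i <= f' i) -> qsum f q <= qsum f' q.
Proof. by move=> ff'; apply: ler_sum. Qed.

Lemma qsum_ge0 f q : (forall i, 0 <= f i) -> 0 <= qsum f q.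
Proof. by move=> f0; apply: sumr_ge0. Qed.

Lemma qsumD f f' q : qsum (fun i => f i + f' i) q = qsum f q + qsum f' q.
Proof. exact: big_split. Qed.

Lemma qsumB f f' q : qsum (fun i => f i - f' i) q = qsum f q - qsum f' q.
Proof. exact: sumrB. Qed.

Lemma qsumZ (c : R) f q : qsum (fun i => c * f i) q = c * qsum f q.
Proof. by rewrite /qsum big_distrr. Qed.

Lemma qsum_cst (c : R) q : qsum (fun=> c) q = c * (size q)%:R.
Proof. by rewrite /qsum big_const_seq count_predT iter_addr_0 mulr_natr. Qed.

Lemma qsum_mask f m q : size m = size q ->
  qsum f q = qsum f (mask m q) + qsum f (unserved m q).
Proof.
rewrite /unserved; elim: q m => [|x q IH] [|b m] //=.
  by rewrite !qsum_nil addr0.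
by case=> /IH e; case: b; rewrite /= !qsum_cons e; ring.
Qed.

Lemma qsum_new_jobs f q t a :
  qsum f (q ++ new_jobs M t a) = f (root M) * a%:R + qsum f q.
Proof.
rewrite /qsum big_cat addrC big_map /=; congr (_ + _).
by rewrite big_const_seq count_predT size_iota iter_addr_0 mulr_natr.
Qed.

Lemma expect_move_next f i : expect (move i) (oapp f 0) = next f i.
Proof. by rewrite expect_move mulr0 add0r. Qed.

Let move_tail (x : job * state M) q (o : option (state M)) :
    fdist R (queue M) :=
  fbind (move_all q)
    (fun q' => fret R (if o is Some k then (x.1, k) :: q' else q')).

Let qsum_moved f (x : job * state M) o q :
  qsum f (if o is Some k then (x.1, k) :: q else q) = qsum f q + oapp f 0 o.
Proof. by case: o => [k|] /=; rewrite ?addr0// qsum_cons addrC. Qed.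

Let expect_move_tail f x q o :
  expect (move_tail x q o) (qsum f) = expect (move_all q) (qsum f) + oapp f 0 o.
Proof.
by rewrite expect_map -expectDr; apply: eq_expect; exact: qsum_moved.
Qed.

Let var_move_tail f x q o :
  var (move_tail x q o) (qsum f) = var (move_all q) (qsum f).
Proof.
rewrite var_map -[RHS](varDr _ (oapp f 0 o)).
by apply: eq_var; exact: qsum_moved.
Qed.

Lemma expect_move_all f q : expect (move_all q) (qsum f) = qsum (next f) q.
Proof.
elim: q => [|x q IH] /=; first by rewrite expect_ret !qsum_nil.
rewrite expect_bind (eq_expect _ (expect_move_tail f x q)) IH qsum_cons.
by rewrite -expect_move_next -expectDr; apply: eq_expect => o; rewrite addrC.
Qed.

Lemma var_move_all_le f q : (forall k, 0 <= f k <= 1) ->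
  var (move_all q) (qsum f) <= qsum (next f) q.
Proof.
move=> f01; elim: q => [|x q IH] /=; first by rewrite var_ret qsum_nil.
have moved o : expect (move_tail x q o) (qsum f) = oapp f 0 o + qsum (next f) q.
  by rewrite expect_move_tail expect_move_all addrC.
rewrite var_bind (eq_expect _ (var_move_tail f x q)) (eq_var _ moved).
rewrite expect_cst varDr qsum_cons addrC lerD// -expect_move_next.
by apply: var_le_expect => -[k|] //=; rewrite lexx ler01.
Qed.

End QueueSums.

Section Dynamics.
Variables (R : realType) (M : model R) (N : nat) (alg : algorithm M).
Implicit Types (h : history M) (n : nat).
Implicit Types (f : state M -> R) (A : pred (state M)).

Local Notation E t := (expect (law N alg t)).
Local Notation step h := (expect (one_period N alg h)).
Local Notation Eservers := (expect (fbinom N (mu_prob M))).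
Local Notation lamN := (lambda M * N%:R).
Local Notation muN := (mu M * N%:R).
Local Notation empty := (([::], [::]) : history M).
Local Notation inA A := (fun i => (A i)%:R : R).

Let lamN_ge0 : 0 <= lamN.
Proof. by rewrite mulr_ge0//; case/andP: (lambda_prob M). Qed.

Let lamN_le : lamN <= N%:R.
Proof. by rewrite ler_piMl//; case/andP: (lambda_prob M). Qed.

Definition taken h n : queue M := mask (alg h n) h.2.
Definition kept h n : queue M := unserved (alg h n) h.2.

Definition work_conserving : Prop :=
  forall h n, size (taken h n) = minn n (size h.2).

Definition prioritizes A : Prop := forall h n x y,
  x \in taken h n -> y \in kept h n -> A y.2 -> A x.2.

Definition next_history h n (q : queue M) (a : nat) : history M :=
  (Period n h.2 (alg h n) a :: h.1, q ++ new_jobs M (size h.1) a).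

Definition transition h n : fdist R (history M) :=
  fbind (move_all (kept h n)) (fun q =>
    fbind (fbinom N (lambda_prob M)) (fun a => fret R (next_history h n q a))).

Lemma expect_one_period h (F : history M -> R) :
  step h F = Eservers (fun n => expect (transition h n) F).
Proof. exact: expect_bind. Qed.

Lemma var_one_period h (F : history M -> R) :
  var (one_period N alg h) F =
  Eservers (fun n => var (transition h n) F) +
  var (fbinom N (mu_prob M)) (fun n => expect (transition h n) F).
Proof. exact: var_bind. Qed.

Lemma eq_expect_transition h n (F G : history M -> R) :
  (forall q a, F (next_history h n q a) = G (next_history h n q a)) ->
  expect (transition h n) F = expect (transition h n) G.
Proof.
move=> FG; rewrite !expect_bind; apply: eq_expect => q.
by rewrite !expect_map; apply: eq_expect => a; exact: FG.
Qed.

Lemma eq_var_transition h n (F G : history M -> R) :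
  (forall q a, F (next_history h n q a) = G (next_history h n q a)) ->
  var (transition h n) F = var (transition h n) G.
Proof.
move=> FG; rewrite !varE (eq_expect_transition FG); congr (_ - _).
by apply: eq_expect_transition => q a; rewrite FG.
Qed.

Lemma expect_transition_qsum h n f :
  expect (transition h n) (fun h' => qsum f h'.2) =
  qsum (next f) (kept h n) + lamN * f (root M).
Proof.
rewrite expect_bind -expect_move_all -expectDr; apply: eq_expect => q.
rewrite expect_map (@eq_expect _ _ _ _ (fun a => f (root M) * a%:R + qsum f q)).
  by rewrite expectDr expectZ expect_fbinom_mean; ring.
by move=> a; exact: qsum_new_jobs.
Qed.

Lemma var_transition_qsum_le h n f : (forall i, 0 <= f i <= 1) ->
  var (transition h n) (fun h' => qsum f h'.2) <=
  qsum (next f) (kept h n) + lamN * f (root M).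
Proof.
move=> f01; have /andP[lam0 lam1] := lambda_prob M.
have /andP[f0 f1] := f01 (root M).
have arrivals q a : qsum f (next_history h n q a).2 =
    f (root M) * a%:R + qsum f q by exact: qsum_new_jobs.
rewrite var_bind addrC; apply: lerD.
  rewrite (@eq_var _ _ _ _ (fun q => qsum f q + f (root M) * lamN)) => [|q].
    by rewrite varDr; exact: var_move_all_le.
  by rewrite expect_map (eq_expect _ (arrivals q)) expectDr expectZ
    expect_fbinom_mean addrC.
apply: expect_le => q.
rewrite var_map (eq_var _ (arrivals q)) varDr varZ var_fbinom.
have -> : f (root M) ^+ 2 * (lambda M * (1 - lambda M) * N%:R) =
    lamN * f (root M) * (f (root M) * (1 - lambda M)) by ring.
by rewrite ler_piMr ?mulr_ge0 ?mulr_ile1 ?subr_ge0 ?gerBl.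
Qed.

Lemma step_qsum h f :
  step h (fun h' => qsum f h'.2) =
  Eservers (fun n => qsum (next f) (kept h n)) + lamN * f (root M).
Proof.
rewrite expect_one_period -expectDr; apply: eq_expect => n.
exact: expect_transition_qsum.
Qed.

Lemma dynkin_formula (F : history M -> R) T :
  E T F = F empty + \sum_(t < T) E t (fun h => step h F - F h).
Proof.
elim: T => [|T IH]; first by rewrite expect_ret big_ord0 addr0.
rewrite big_ord_recr /= expect_bind addrA -IH -expectD.
by apply: eq_expect => h; rewrite addrC subrK.
Qed.

Lemma sum_expect_le_drift (F G K : history M -> R) T :
  F empty = 0 -> (forall h, 0 <= F h) ->
  (forall h, step h F + K h <= F h + G h) ->
  \sum_(t < T) E t K <= \sum_(t < T) E t G.
Proof.
move=> Fempty F0 drift; rewrite -subr_ge0 -sumrB.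
have : 0 <= E T F by exact: expect_ge.
rewrite dynkin_formula Fempty add0r => /le_trans; apply; apply: ler_sum => t _.
by rewrite -expectB; apply: le_expect => h; have := drift h; lra.
Qed.

Definition unserved_cost h : R :=
  Eservers (fun n => qsum (@cost _ M) (kept h n)).

Lemma expect_total_cost T :
  E T (@total_cost _ M) = \sum_(t < T) E t unserved_cost.
Proof.
rewrite dynkin_formula /total_cost big_nil add0r; apply: eq_bigr => t _.
apply: eq_expect => h; rewrite expect_one_period /unserved_cost.
apply/eqP; rewrite subr_eq -expectDr; apply/eqP/eq_expect => n.
rewrite -[RHS](expect_cst (transition h n)).
by apply: eq_expect_transition => q a; rewrite big_cons.
Qed.

Definition excess A h : R := Eservers (fun n => qsum (inA A) (kept h n)).

Definition shortage A h : R :=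
  Eservers (fun n => n%:R - qsum (inA A) (taken h n)).

(* A job served [j] periods before the most recent one counts with weight
   [w (k + j)]. *)
Fixpoint past_served (w : nat -> state M -> R) k (l : seq (period M)) : R :=
  if l is p :: l' then
    qsum (w k) (mask (served p) (waiting p)) + past_served w k.+1 l'
  else 0.

Lemma past_served_ge0 w k l :
  (forall n i, 0 <= w n i) -> 0 <= past_served w k l.
Proof.
by move=> w0; elim: l k => //= p l IH k; rewrite addr_ge0 ?qsum_ge0.
Qed.

Lemma past_served_rec (v w : nat -> state M -> R) k l :
  (forall n i, w n i = v n i + w n.+1 i) ->
  past_served w k l = past_served v k l + past_served w k.+1 l.
Proof.
move=> rec; elim: l k => [|p l IH] k /=; first by rewrite addr0.
by rewrite (eq_qsum _ (rec k)) qsumD IH; ring.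
Qed.

Lemma expect_transition_past_served w k h n :
  expect (transition h n) (fun h' => past_served w k h'.1) =
  qsum (w k) (taken h n) + past_served w k.+1 h.1.
Proof.
by rewrite -[RHS](expect_cst (transition h n)); exact: eq_expect_transition.
Qed.

Section Feasible.
Hypothesis feas : feasible alg.

Lemma qsum_queue h n f :
  qsum f h.2 = qsum f (taken h n) + qsum f (kept h n).
Proof. by apply: qsum_mask; have [] := feas h n. Qed.

Lemma qsum_kept_le h n f :
  (forall i, 0 <= f i) -> qsum f (kept h n) <= qsum f h.2.
Proof. by move=> f0; rewrite (qsum_queue h n) lerDr qsum_ge0. Qed.

Lemma size_taken h n : size (taken h n) = count id (alg h n).
Proof. by have [sz _] := feas h n; rewrite size_mask. Qed.

Lemma qsum_taken_le h n (c : R) f : 0 <= c -> (forall i, f i <= c) ->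
  qsum f (taken h n) <= c * n%:R.
Proof.
move=> c0 fc; apply: le_trans (le_qsum _ fc) _.
by rewrite qsum_cst ler_wpM2l// size_taken ler_nat; have [] := feas h n.
Qed.

Lemma expect_qsum_le (c : R) f T : 0 <= c -> (forall i, f i <= c) ->
  E T (fun h => qsum f h.2) <= c * (N%:R / theta M).
Proof.
move=> c0 fc; have th1 := theta_le1 M; have th := theta_gt0 M.
apply: (@le_trans _ _ (E T (fun h => qsum (fun=> c) h.2))).
  by apply: le_expect => h; exact: le_qsum.
elim: T => [|T IH].
  by rewrite expect_ret qsum_nil mulr_ge0// divr_ge0// theta_ge0.
rewrite /= expect_bind.
apply: (@le_trans _ _
    (E T (fun h => (1 - theta M) * qsum (fun=> c) h.2 + c * N%:R))).
  apply: le_expect => h; rewrite step_qsum lerD//; last first.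
    by rewrite mulrC ler_wpM2l.
  apply: expect_le => n.
  apply: (@le_trans _ _ (qsum (fun=> (1 - theta M) * c) (kept h n))).
    by apply: le_qsum => i; exact: next_le.
  by rewrite qsumZ ler_wpM2l ?subr_ge0 ?qsum_kept_le.
rewrite expectDr expectZ.
have -> : c * (N%:R / theta M) =
    (1 - theta M) * (c * (N%:R / theta M)) + c * N%:R.
  by field; rewrite gt_eqF.
by rewrite lerD2r ler_wpM2l// subr_ge0.
Qed.

Section Duality.
Variable g : R.
Hypothesis g_ge0 : 0 <= g.

Definition dual_value : R := N%:R * (lambda M * V g (root M) - mu M * g).

(* Complementary slackness: a kept job should not have an index above the price,
   a taken job should not have one below, and no server should stay idle. *)
Definition duality_gap h : R := Eservers (fun n =>
  qsum (fun i => oarc_index g i - V g i) (kept h n) +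
  (g * n%:R - qsum (V g) (taken h n))).

Lemma unserved_cost_duality h :
  unserved_cost h + step h (fun h' => qsum (V g) h'.2) =
  qsum (V g) h.2 + (dual_value + duality_gap h).
Proof.
have -> : qsum (V g) h.2 + (dual_value + duality_gap h) =
    duality_gap h - g * muN + qsum (V g) h.2 + lamN * V g (root M).
  by rewrite /dual_value; ring.
rewrite step_qsum addrA; congr (_ + _).
rewrite -(expect_fbinom_mean (mu_prob M)) -expectZ -expectB -expectDr -expectD.
apply: eq_expect => n; rewrite (qsum_queue h n).
have -> : qsum (fun i => oarc_index g i - V g i) (kept h n) =
    qsum (@cost _ M) (kept h n) + qsum (next (V g)) (kept h n) -
    qsum (V g) (kept h n) by rewrite -qsumD -qsumB.
by ring.
Qed.

Lemma duality_gap_ge0 h : 0 <= duality_gap h.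
Proof.
apply: expect_ge => n; rewrite addr_ge0//.
  by apply: qsum_ge0 => i; rewrite subr_ge0 V_le_index.
by rewrite subr_ge0 qsum_taken_le// => i; exact: V_le_price.
Qed.

Lemma duality_gap_le h :
  duality_gap h <=
  g * shortage (at_least g) h + index_bound M * excess (above g) h.
Proof.
rewrite addrC /shortage /excess -!expectZ -expectD.
apply: le_expect => n; rewrite lerD//.
  rewrite -qsumZ; apply: le_qsum => i.
  rewrite V_min_index /above; case: ltP => gi.
    rewrite mulr1; apply: le_trans (oarc_index_le g i).
    by rewrite gerBl.
  by rewrite subrr mulr0.
rewrite mulrBr lerD2l lerN2 -qsumZ; apply: le_qsum => i.
rewrite V_min_index /at_least; case: (leP g) => gi; first by rewrite mulr1.
by rewrite mulr0 -(min_r (ltW gi)) -V_min_index V_ge0.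
Qed.

Lemma expect_total_cost_duality T :
  E T (@total_cost _ M) + E T (fun h => qsum (V g) h.2) =
  T%:R * dual_value + \sum_(t < T) E t duality_gap.
Proof.
rewrite expect_total_cost dynkin_formula qsum_nil add0r -big_split /=.
rewrite mulr_natl_sum -big_split /=.
apply: eq_bigr => t _; rewrite -expectD [RHS]addrC -expectDr.
by apply: eq_expect => h; have := unserved_cost_duality h; lra.
Qed.

Lemma expect_total_cost_ge T :
  T%:R * dual_value - g * (N%:R / theta M) <= E T (@total_cost _ M).
Proof.
have := expect_qsum_le T g_ge0 (V_le_price g).
have : 0 <= \sum_(t < T) E t duality_gap.
  by apply: sumr_ge0 => t _; apply: expect_ge; exact: duality_gap_ge0.
by have := expect_total_cost_duality T; lra.
Qed.

Lemma expect_total_cost_le T :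
  E T (@total_cost _ M) <= T%:R * dual_value + \sum_(t < T) E t duality_gap.
Proof.
rewrite -expect_total_cost_duality lerDl; apply: expect_ge => h.
by apply: qsum_ge0 => i; exact: V_ge0.
Qed.

End Duality.

Section FirstHits.
Variable A : pred (state M).

(* Mean number, per period, of first visits to [A] by the jobs that arrived in
   the last [n] periods, if no job were ever served. *)
Definition mean_hits n : R := lamN * \sum_(m < n) first_hit A m (root M).

(* Expected number of first visits to [A] in [n] periods from now if no job is
   served from now on, including the visits that jobs served earlier would have
   made. Re-counting the served jobs is what makes this a martingale, whatever
   the algorithm does. *)
Definition foreseen n h : R :=
  qsum (first_hit A n) h.2 + past_served (first_hit A) n.+1 h.1 + mean_hits n.

Lemma mean_hits0 : mean_hits 0 = 0.
Proof. by rewrite /mean_hits big_ord0 mulr0. Qed.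

Lemma mean_hitsS n :
  mean_hits n.+1 = mean_hits n + lamN * first_hit A n (root M).
Proof. by rewrite /mean_hits big_ord_recr /= mulrDr. Qed.

Lemma mean_hits_ge0 n : 0 <= mean_hits n.
Proof.
rewrite mulr_ge0 ?lamN_ge0//; apply: sumr_ge0 => m _.
exact: first_hit_ge0.
Qed.

Lemma sum_first_hit_root n :
  \sum_(m < n) first_hit A m (root M) = \sum_(m < n) hit_at A m (root M).
Proof. by apply: eq_bigr => m _; rewrite /first_hit fresh_root. Qed.

Lemma mean_hits_le n : mean_hits n <= lamN * hit A (root M).
Proof.
by rewrite /mean_hits sum_first_hit_root ler_wpM2l ?lamN_ge0 ?sum_hit_at_le.
Qed.

Lemma mean_hits_late n :
  (nlevels M <= n)%N -> mean_hits n = lamN * hit A (root M).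
Proof. by move=> Ln; rewrite /mean_hits sum_first_hit_root sum_hit_at. Qed.

Lemma expect_transition_foreseen n h k :
  expect (transition h k) (foreseen n) = foreseen n.+1 h.
Proof.
rewrite expectDr expectD expect_transition_qsum expect_transition_past_served.
rewrite /foreseen mean_hitsS (qsum_queue h k).
by rewrite -!(eq_qsum _ (first_hitS A n)); ring.
Qed.

Lemma step_foreseen n h : step h (foreseen n) = foreseen n.+1 h.
Proof.
rewrite expect_one_period (eq_expect _ (expect_transition_foreseen n h)).
exact: expect_cst.
Qed.

Lemma expect_foreseen t n : E t (foreseen n) = mean_hits (n + t).
Proof.
elim: t n => [|t IH] n.
  by rewrite expect_ret /foreseen qsum_nil /= !add0r addn0.
rewrite /= expect_bind -addSnnS -IH; apply: eq_expect => h.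
exact: step_foreseen.
Qed.

Lemma var_step_foreseen_le n h :
  var (one_period N alg h) (foreseen n) <=
  qsum (first_hit A n.+1) h.2 + lamN * first_hit A n (root M).
Proof.
rewrite var_one_period (eq_var _ (expect_transition_foreseen n h)).
rewrite var_cst addr0.
apply: expect_le => k.
rewrite (@eq_var_transition _ _ _ (fun h' => qsum (first_hit A n) h'.2 +
  (qsum (first_hit A n.+1) (taken h k) + past_served (first_hit A) n.+2 h.1 +
   mean_hits n))) => [|q a]; last by rewrite addrA.
rewrite varDr; apply: le_trans (var_transition_qsum_le _ _ _) _ => [i|].
  by rewrite first_hit_ge0 first_hit_le1 ?theta_ge0.
rewrite lerD2r -(eq_qsum _ (first_hitS A n)) qsum_kept_le// => i.
exact: first_hit_ge0.
Qed.

Lemma expect_var_step_foreseen_le t n :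
  E t (fun h => var (one_period N alg h) (foreseen n)) <= N%:R.
Proof.
apply: (@le_trans _ _ (E t (fun h => foreseen n.+1 h - mean_hits n))).
  apply: le_expect => h; apply: le_trans (var_step_foreseen_le n h) _.
  rewrite /foreseen mean_hitsS addrA addrAC addrK addrAC lerDl.
  by apply: past_served_ge0 => m i; exact: first_hit_ge0.
rewrite expectDr expect_foreseen lerBlDr ler_wpDr ?mean_hits_ge0//.
apply: le_trans (mean_hits_le _) (le_trans _ lamN_le).
by rewrite ler_piMr// hit_le1 ?theta_ge0.
Qed.

Lemma var_foreseen_le t n :
  var (law N alg t) (foreseen n) <= (nlevels M - n)%:R * N%:R.
Proof.
elim: t n => [|t IH] n; first by rewrite var_ret mulr_ge0.
rewrite /= var_bind (eq_var _ (step_foreseen n)).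
have [Ln|nL] := leqP (nlevels M) n; last first.
  rewrite -(subnSK nL) -natr1 mulrDl mul1r addrC lerD//.
  exact: expect_var_step_foreseen_le.
rewrite -[leRHS]add0r lerD//.
  apply: expect_le => h; apply: le_trans (var_step_foreseen_le n h) _.
  rewrite (eq_qsum _ (f' := fun=> 0)) => [|i].
    rewrite qsum_cst mul0r add0r first_hit_late ?mulr0//.
    by rewrite (leq_trans Ln) ?leq_addl.
  by rewrite first_hit_late// (leq_trans Ln)// addnS leqW ?leq_addl.
by apply: le_trans (IH _) _; rewrite ler_wpM2r// ler_nat leq_sub2l.
Qed.

Definition noise : R := Num.sqrt ((nlevels M)%:R * N%:R).

Lemma noise_ge0 : 0 <= noise.
Proof. exact: sqrtr_ge0. Qed.

Lemma expect_foreseen_dist_le t :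
  E t (fun h => `|foreseen 0 h - mean_hits t|) <= noise.
Proof.
have := expect_dist_mean_le (law N alg t) (foreseen 0).
rewrite expect_foreseen => /le_trans; apply; apply: ler_wsqrtr.
by rewrite -[X in X%:R]subn0 var_foreseen_le.
Qed.

Lemma expect_servers_dist_le : Eservers (fun n => `|n%:R - muN|) <= noise.
Proof.
have := expect_dist_mean_le (fbinom N (mu_prob M)) (fun n => n%:R).
rewrite expect_fbinom_mean => /le_trans; apply; apply: ler_wsqrtr.
have /andP[mu0 mu1] := mu_prob M.
rewrite var_fbinom ler_wpM2r// (@le_trans _ _ 1) ?ler1n ?nlevels_gt0//.
by rewrite mulr_ile1 ?subr_ge0 ?gerBl.
Qed.

Definition revisits h : R := qsum (fun i => (A i && ~~ fresh A i)%:R) h.2.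
Definition missed h : R := past_served (first_hit A) 1 h.1.

Lemma revisits_ge0 h : 0 <= revisits h.
Proof. exact: qsum_ge0. Qed.

Lemma missed_ge0 h : 0 <= missed h.
Proof. by apply: past_served_ge0 => n i; exact: first_hit_ge0. Qed.

Lemma qsum_in h : qsum (inA A) h.2 = foreseen 0 h + revisits h - missed h.
Proof.
rewrite /foreseen mean_hits0 -/(missed h).
have -> : qsum (inA A) h.2 = qsum (first_hit A 0) h.2 + revisits h.
  rewrite -qsumD; apply: eq_qsum => i; rewrite first_hit0.
  by case: (A i); case: (fresh A i); rewrite /= ?addr0 ?add0r.
by ring.
Qed.

(* An unserved job of [A] returns to [A] with probability at most [1 - theta],
   and it must have been unserved there to return. *)
Lemma sum_revisits_le T :
  \sum_(t < T) E t revisits <= (1 - theta M) * \sum_(t < T) E t (excess A).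
Proof.
rewrite mulr_sumr; under [leRHS]eq_bigr do rewrite -expectZ.
apply: (sum_expect_le_drift (F := fun h => qsum (revisit A) h.2)) => [|h|h].
- exact: qsum_nil.
- by apply: qsum_ge0 => i; exact: revisit_ge0.
rewrite step_qsum {2}/revisit fresh_root mulr0 addr0.
pose stay i : R := (~~ A i)%:R * revisit A i.
have stay_ge0 i : 0 <= stay i by rewrite mulr_ge0 ?revisit_ge0.
have -> : qsum (revisit A) h.2 = revisits h + qsum stay h.2.
  by rewrite -qsumD; apply: eq_qsum => i; exact: revisit_split.
rewrite addrC -addrA lerD2l addrC -expectZ -expectDr; apply: le_expect => n.
apply: le_trans (lerD (lexx _) (qsum_kept_le h n stay_ge0)).
rewrite -qsumZ -qsumD; apply: le_qsum => i.
exact: (next_revisit_le A (theta_ge0 M) i).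
Qed.

(* Only jobs served outside [A] are missed in [A] later; there are at most as
   many of them as the shortage, and each would have reached [A] with
   probability at most [1 - theta]. *)
Lemma sum_missed_le T :
  \sum_(t < T) E t missed <= (1 - theta M) * \sum_(t < T) E t (shortage A).
Proof.
rewrite mulr_sumr; under [leRHS]eq_bigr do rewrite -expectZ.
pose potential h := past_served (later_hits A) 1 h.1.
apply: (sum_expect_le_drift (F := potential)) => // h.
  by apply: past_served_ge0 => n i; exact: later_hits_ge0.
rewrite /potential (past_served_rec _ _ (later_hits_rec A)) -/(missed h).
rewrite addrC -addrA lerD2l addrC -expectZ -expectDr expect_one_period.
apply: le_expect => n; rewrite expect_transition_past_served lerD2r.
apply: le_trans (le_qsum _ (later_hits1_le A (theta_ge0 M))) _.
rewrite qsumZ ler_wpM2l ?subr_ge0 ?theta_le1// lerBrDr -qsumD.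
rewrite -[leRHS]mul1r; apply: qsum_taken_le => // i.
by case: (A i); rewrite /= ?addr0 ?add0r.
Qed.

Definition fluctuation t h n : R :=
  `|n%:R - muN| + `|foreseen 0 h - mean_hits t|.

Lemma fluctuation_ge0 t h n : 0 <= fluctuation t h n.
Proof. by rewrite addr_ge0. Qed.

Lemma expect_fluctuation_le t :
  E t (fun h => Eservers (fluctuation t h)) <= 2 * noise.
Proof.
apply: (@le_trans _ _ (E t (fun h => noise + `|foreseen 0 h - mean_hits t|))).
  by apply: le_expect => h; rewrite expectDr lerD2r expect_servers_dist_le.
by rewrite expectD expect_cst mulr_natl mulr2n lerD2l expect_foreseen_dist_le.
Qed.

Lemma expect_le_noise t (F : history M -> nat -> R) (G : history M -> R) c :
  (forall h n, F h n <= fluctuation t h n + G h + c) ->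
  E t (fun h => Eservers (F h)) <= 2 * noise + E t G + c.
Proof.
move=> FG.
apply: le_trans (lerD (lerD (expect_fluctuation_le t) (lexx _)) (lexx _)).
rewrite -expectD -expectDr; apply: le_expect => h; rewrite -addrA -expectDr.
by apply: le_expect => n; rewrite addrA.
Qed.

Lemma queue_servers_dist_le t h n :
  `|qsum (inA A) h.2 - n%:R - (mean_hits t - muN) - (revisits h - missed h)| <=
  fluctuation t h n.
Proof.
have -> : qsum (inA A) h.2 - n%:R - (mean_hits t - muN) -
    (revisits h - missed h) = (foreseen 0 h - mean_hits t) - (n%:R - muN).
  by rewrite qsum_in; ring.
by rewrite [leRHS]addrC; exact: ler_normB.
Qed.

Section Priority.
Hypothesis busy : work_conserving.
Hypothesis A_first : prioritizes A.

Lemma taken_in_full h n : has (fun x => A x.2) (kept h n) ->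
  qsum (inA A) (taken h n) = n%:R.
Proof.
move=> /hasP[y y_kept Ay].
have taken_in : {in taken h n, forall x, A x.2}.
  by move=> x x_taken; exact: A_first x_taken y_kept Ay.
have -> : qsum (inA A) (taken h n) = qsum (fun=> 1) (taken h n).
  by rewrite /qsum big_seq [RHS]big_seq; apply: eq_bigr => x /taken_in ->.
have kept_gt0 : (0 < size (kept h n))%N by case: (kept h n) y_kept.
have := qsum_queue h n (fun=> 1); rewrite !qsum_cst !mul1r busy -natrD.
move=> /eqP; rewrite eqr_nat => /eqP; case: leqP => // _ /eqP.
by rewrite -[X in X == _]addn0 eqn_add2l eq_sym -leqn0 leqNgt kept_gt0.
Qed.

Lemma qsum_taken_in h n :
  qsum (inA A) (taken h n) = Num.min n%:R (qsum (inA A) h.2).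
Proof.
rewrite (qsum_queue h n); case: (boolP (has (fun x => A x.2) (kept h n))).
  by move=> /taken_in_full ->; rewrite min_l// lerDl qsum_ge0.
rewrite -all_predC => /allP kept_out.
have -> : qsum (inA A) (kept h n) = 0.
  by rewrite /qsum big_seq; apply: big1 => x /kept_out /= /negbTE ->.
rewrite addr0 min_r// -[leRHS]mul1r; apply: qsum_taken_le => // i.
by case: (A i).
Qed.

Lemma qsum_kept_in h n :
  qsum (inA A) (kept h n) = Num.max 0 (qsum (inA A) h.2 - n%:R).
Proof.
have := qsum_queue h n (inA A); rewrite qsum_taken_in => split_in.
by case: leP split_in => ?; case: leP => ? ?; lra.
Qed.

Lemma shortage_in h n :
  n%:R - qsum (inA A) (taken h n) = Num.max 0 (n%:R - qsum (inA A) h.2).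
Proof. by rewrite qsum_taken_in; case: leP => ?; case: leP => ?; lra. Qed.

Lemma expect_excess_le t :
  E t (excess A) <= 2 * noise + E t revisits + Num.max 0 (mean_hits t - muN).
Proof.
apply: expect_le_noise => h n; rewrite qsum_kept_in ge_max; apply/andP.
have := missed_ge0 h; have := revisits_ge0 h; have := fluctuation_ge0 t h n.
have := queue_servers_dist_le t h n; rewrite ler_norml => /andP[_].
by case: (leP 0 (mean_hits t - muN)); split; lra.
Qed.

Lemma expect_shortage_le t :
  E t (shortage A) <= 2 * noise + E t missed + Num.max 0 (muN - mean_hits t).
Proof.
apply: expect_le_noise => h n; rewrite shortage_in ge_max; apply/andP.
have := missed_ge0 h; have := revisits_ge0 h; have := fluctuation_ge0 t h n.
have := queue_servers_dist_le t h n; rewrite ler_norml => /andP[+ _].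
by case: (leP 0 (muN - mean_hits t)); split; lra.
Qed.

Lemma sum_excess_le T : lambda M * hit A (root M) <= mu M ->
  theta M * \sum_(t < T) E t (excess A) <= T%:R * (2 * noise).
Proof.
move=> hit_le; have := sum_revisits_le T.
suff : \sum_(t < T) E t (excess A) <=
    T%:R * (2 * noise) + \sum_(t < T) E t revisits by lra.
rewrite mulr_natl_sum -big_split /=.
apply: ler_sum => t _; have := expect_excess_le t.
rewrite max_l ?addr0// subr_le0; apply: le_trans (mean_hits_le _) _.
by rewrite mulrAC ler_wpM2r.
Qed.

(* The deficit is that of the first [nlevels M] periods, when the jobs that
   would by then be deep in the tree have not arrived yet. *)
Lemma sum_mean_hits_deficit_le T : mu M <= lambda M * hit A (root M) ->
  \sum_(t < T) Num.max 0 (muN - mean_hits t) <= (nlevels M)%:R * N%:R.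
Proof.
move=> hit_ge; have /andP[mu0 mu1] := mu_prob M.
set deficit := fun t => Num.max 0 (muN - mean_hits t).
apply: (@le_trans _ _ (\sum_(t < nlevels M + T) deficit t)).
  rewrite addnC big_split_ord /= lerDl; apply: sumr_ge0 => t _.
  by rewrite le_max lexx.
rewrite big_split_ord /= [X in _ + X]big1 ?addr0 => [|t _]; last first.
  rewrite /deficit mean_hits_late ?leq_addr// max_l// subr_le0.
  by rewrite mulrAC ler_wpM2r.
rewrite mulr_natl_sum; apply: ler_sum => t _.
rewrite ge_max ler0n /=; apply: (@le_trans _ _ muN); last by rewrite ler_piMl.
by rewrite gerBl mean_hits_ge0.
Qed.

Lemma sum_shortage_le T : mu M <= lambda M * hit A (root M) ->
  theta M * \sum_(t < T) E t (shortage A) <=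
  T%:R * (2 * noise) + (nlevels M)%:R * N%:R.
Proof.
move=> hit_ge.
have := sum_missed_le T; have := sum_mean_hits_deficit_le T hit_ge.
suff : \sum_(t < T) E t (shortage A) <= T%:R * (2 * noise) +
    \sum_(t < T) E t missed + \sum_(t < T) Num.max 0 (muN - mean_hits t) by lra.
rewrite mulr_natl_sum -!big_split /=.
by apply: ler_sum => t _; exact: expect_shortage_le.
Qed.

End Priority.
End FirstHits.
End Feasible.
End Dynamics.

Section OaRCCost.
Variables (R : realType) (M : model R) (N : nat) (alg : algorithm M).
Variables (g : R) (before : rel (state M)).
Hypothesis g_opt : dual_minimizer M g.
Hypothesis before_index : tie_breaking g before.
Hypothesis oarc : is_OaRC before alg.

Local Notation E t := (expect (law N alg t)).
Local Notation L := (nlevels M).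

Let feas : feasible alg := OaRC_feasible oarc.

Lemma oarc_work_conserving : work_conserving alg.
Proof. by move=> h n; have [_ <- _] := oarc h n; exact: size_taken. Qed.

Lemma oarc_prioritizes (A : pred (state M)) :
  (forall i k, A i -> ~~ A k -> oarc_index g k < oarc_index g i) ->
  prioritizes alg A.
Proof.
move=> A_index h n x y x_taken y_kept Ay; apply/negPn/negP => nAx.
have [_ _ _ by_index] := before_index.
have [_ _ /(_ x y x_taken y_kept)] := oarc h n.
by rewrite by_index// A_index.
Qed.

Lemma oarc_prioritizes_above : prioritizes alg (above g).
Proof.
apply: oarc_prioritizes => i k; rewrite /above -leNgt => gi kg.
exact: le_lt_trans kg gi.
Qed.

Lemma oarc_prioritizes_at_least : prioritizes alg (at_least g).
Proof.
apply: oarc_prioritizes => i k; rewrite /at_least -ltNge => gi kg.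
exact: lt_le_trans kg gi.
Qed.

Lemma oarc_sum_excess_le T :
  \sum_(t < T) E t (excess N alg (above g)) <= T%:R * (2 * noise M N) / theta M.
Proof.
rewrite ler_pdivlMr ?theta_gt0// mulrC.
exact: (sum_excess_le _ feas oarc_work_conserving oarc_prioritizes_above
  _ (hit_above_le g_opt)).
Qed.

Lemma oarc_sum_shortage_le T :
  g * \sum_(t < T) E t (shortage N alg (at_least g)) <=
  index_bound M * ((T%:R * (2 * noise M N) + L%:R * N%:R) / theta M).
Proof.
set bound := _ / theta M.
have bound0 : 0 <= bound.
  by rewrite divr_ge0 ?theta_ge0// addr_ge0 ?mulr_ge0 ?noise_ge0.
have [g0 _] := g_opt; have [g_eq0|g_neq0] := eqVneq g 0.
  by rewrite g_eq0 mul0r mulr_ge0 ?index_bound_ge0.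
have g_gt0 : 0 < g by rewrite lt_neqAle eq_sym g_neq0.
apply: (@le_trans _ _ (g * bound)); last first.
  by rewrite ler_wpM2r ?dual_minimizer_le.
rewrite ler_wpM2l// ler_pdivlMr ?theta_gt0// mulrC.
exact: (sum_shortage_le _ feas oarc_work_conserving oarc_prioritizes_at_least
  _ (hit_at_least_ge g_opt g_gt0)).
Qed.

Lemma oarc_sum_duality_gap_le T :
  \sum_(t < T) E t (duality_gap N alg g) <=
  index_bound M / theta M * (T%:R * (4 * noise M N) + L%:R * N%:R).
Proof.
have [g0 _] := g_opt.
have gap_le : \sum_(t < T) E t (duality_gap N alg g) <=
    g * \sum_(t < T) E t (shortage N alg (at_least g)) +
    index_bound M * \sum_(t < T) E t (excess N alg (above g)).
  rewrite !mulr_sumr -big_split; apply: ler_sum => t _ /=.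
  by rewrite -!expectZ -expectD; apply: le_expect => h; exact: duality_gap_le.
have := ler_wpM2l (index_bound_ge0 M) (oarc_sum_excess_le T).
by have := oarc_sum_shortage_le T; lra.
Qed.

Lemma oarc_total_cost_le T :
  E T (@total_cost _ M) <=
  T%:R * (dual_value M N g + 4 * (index_bound M / theta M) * noise M N) +
  index_bound M / theta M * (L%:R * N%:R).
Proof.
have [g0 _] := g_opt; have := oarc_sum_duality_gap_le T.
by have := expect_total_cost_le N feas g0 T; lra.
Qed.

End OaRCCost.

Section RealAnalysis.
Variable R : realType.
Implicit Types (u v : nat -> \bar R) (a : nat -> R) (K C : R).

Lemma le_limn_esup u v : (\forall n \near \oo, u n <= v n)%E ->
  (limn_esup u <= limn_esup v)%E.
Proof.
move=> uv; apply/ereal_infP => _ [V V_near <-].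
apply: ge_ereal_inf; exists (ereal_sup (u @` (V `&` [set n | (u n <= v n)%E]))).
  by exists (V `&` [set n | (u n <= v n)%E]) => //; exact: filterI.
apply: ge_ereal_sup => _ [n [Vn uvn] <-]; apply: le_trans uvn _.
by apply: ereal_sup_ubound; exists n.
Qed.

Lemma cvg_natrV : (n%:R^-1 : R) @[n --> \oo] --> (0 : R).
Proof.
apply/gtr0_cvgV0; last exact: cvgr_idn.
by near=> n; rewrite ltr0n; near: n; exact: nbhs_infty_gt.
Unshelve. all: by end_near. Qed.

Lemma limn_esup_affine_mean K C :
  limn_esup (fun T => (K + C * T%:R^-1)%:E) = K%:E.
Proof.
apply: (cvg_limn_einf_sup _).2; apply: cvg_EFin; first exact: nearW.
rewrite -[X in _ --> X]addr0 -[X in _ + X](mulr0 C).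
by apply: cvgD; [exact: cvg_cst|apply: cvgM; [exact: cvg_cst|exact: cvg_natrV]].
Qed.

Lemma limn_esup_mean_le a K C : (forall T, a T <= T%:R * K + C) ->
  (limn_esup (fun T => (T%:R^-1 * a T)%:E) <= K%:E)%E.
Proof.
move=> aK; rewrite -(limn_esup_affine_mean K C); apply: le_limn_esup.
near=> T; have T0 : 0 < T%:R :> R.
  by rewrite ltr0n; near: T; exact: nbhs_infty_gt.
rewrite lee_fin mulrC ler_pdivrMr// mulrDl mulfVK ?gt_eqF//.
by rewrite [K * _]mulrC.
Unshelve. all: by end_near. Qed.

Lemma limn_esup_mean_ge a K C : (forall T, T%:R * K - C <= a T) ->
  (K%:E <= limn_esup (fun T => (T%:R^-1 * a T)%:E))%E.
Proof.
move=> aK; rewrite -(limn_esup_affine_mean K (- C)); apply: le_limn_esup.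
near=> T; have T0 : 0 < T%:R :> R.
  by rewrite ltr0n; near: T; exact: nbhs_infty_gt.
rewrite lee_fin [leRHS]mulrC ler_pdivlMr// mulrDl mulfVK ?gt_eqF//.
by rewrite [K * _]mulrC.
Unshelve. all: by end_near. Qed.

Lemma cvg_sqrt_mean (c : R) :
  (c * Num.sqrt N%:R * N%:R^-1)%:E @[N --> \oo] --> (0 : \bar R)%E.
Proof.
have sqrt_mean n : c * Num.sqrt n%:R * n%:R^-1 = c * Num.sqrt (n%:R^-1) :> R.
  have [->|n_neq0] := eqVneq n 0%N; first by rewrite invr0 sqrtr0 !mulr0.
  rewrite -{2}(sqr_sqrtr (ler0n R n)) sqrtrV//; field.
  by rewrite sqrtr_eq0 -ltNge ltr0n lt0n.
under eq_cvg do rewrite sqrt_mean.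
apply: cvg_EFin; first exact: nearW.
rewrite -[X in _ --> X](mulr0 c) -(sqrtr0 R); apply: cvgM; first exact: cvg_cst.
by apply: continuous_cvg; [exact: sqrt_continuous|exact: cvg_natrV].
Qed.

Lemma le_1BV_ln (x : R) : 0 < x -> 1 - x^-1 <= ln x.
Proof.
move=> x0; have : -1 < x^-1 - 1 by rewrite ltrBrDr addNr invr_gt0.
by move=> /le_ln1Dx; rewrite addrCA subrr addr0 lnV ?posrE//; lra.
Qed.

End RealAnalysis.

Section Regret.
Variables (R : realType) (M : model R).

Lemma optimal_cost_ge N (g : R) : 0 <= g ->
  ((dual_value M N g)%:E <= optimal_cost M N)%E.
Proof.
move=> g0; apply/ereal_infP => _ [alg feas <-].
by apply: limn_esup_mean_ge => T; exact: expect_total_cost_ge.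
Qed.

Definition regret_factor : R :=
  4 * (index_bound M / theta M) * Num.sqrt (nlevels M)%:R.

Lemma oarc_regret_bounds N (alg : algorithm M) (g : R)
    (before : rel (state M)) :
  dual_minimizer M g -> tie_breaking g before -> is_OaRC before alg ->
  (0 <= regret N alg <= (regret_factor * Num.sqrt N%:R)%:E)%E.
Proof.
move=> g_opt before_index oarc; have [g0 _] := g_opt.
set D := dual_value M N g.
have opt_ge : (D%:E <= optimal_cost M N)%E by exact: optimal_cost_ge.
have avg_le : (average_cost N alg <= (D + regret_factor * Num.sqrt N%:R)%:E)%E.
  rewrite /regret_factor -mulrA -sqrtrM//.
  apply: limn_esup_mean_le => T.
  exact: (oarc_total_cost_le _ g_opt before_index oarc).
have opt_avg : (optimal_cost M N <= average_cost N alg)%E.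
  apply: ereal_inf_lbound; exists alg => //; exact: OaRC_feasible oarc.
have opt_fin : optimal_cost M N \is a fin_num.
  rewrite fin_real// (lt_le_trans (ltNyr _) opt_ge).
  by rewrite (le_lt_trans (le_trans opt_avg avg_le)) ?ltry.
rewrite /regret sube_ge0 ?opt_fin// opt_avg /=.
apply: le_trans (leeB avg_le opt_ge) _.
by rewrite -EFinB lee_fin addrAC subrr add0r.
Qed.

Lemma regret_factor_le_U N : (0 < N)%N ->
  regret_factor <= cost_max M * U (nlevels M) (theta M) N.
Proof.
move=> N0; have L0 := nlevels_gt0 M.
have powL : Num.sqrt (nlevels M)%:R <= (nlevels M)%:R `^ (3 / 2) :> R.
  by rewrite -powR12_sqrt// ler_powR ?ler1n//; lra.
have log_factor (x : R) : 2 <= x -> 4 <= 1610 * ln x ^+ 2.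
  move=> x2; have x0 : 0 < x by exact: lt_le_trans x2.
  have xV : x^-1 <= 2^-1 by rewrite lef_pV2 ?posrE.
  by have := le_1BV_ln x0; nra.
have /log_factor : 2 <= (55 * N * nlevels M)%:R :> R.
  by rewrite ler_nat -mulnA (@leq_trans 55)// leq_pmulr// muln_gt0 N0.
set l := ln _ => l_ge; set w := _ `^ _ in powL.
have -> : regret_factor =
    cost_max M * theta M ^- 2 * (4 * Num.sqrt (nlevels M)%:R).
  by rewrite /regret_factor /index_bound; field; rewrite gt_eqF ?theta_gt0.
have -> : cost_max M * U (nlevels M) (theta M) N =
    cost_max M * theta M ^- 2 * (1610 * l ^+ 2 * w) by rewrite /U -/l -/w; ring.
rewrite ler_wpM2l ?mulr_ge0 ?cost_max_ge0 ?invr_ge0 ?exprn_ge0 ?theta_ge0//.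
by rewrite ler_pM// sqrtr_ge0.
Qed.

End Regret.

Theorem theorem1 (R : realType) (M : model R) (g : R)
    (before : rel (state M)) (OaRC : nat -> algorithm M)
    (hg : dual_minimizer M g)
    (hbefore : tie_breaking g before)
    (hOaRC : forall N : nat, (1 <= N)%N -> is_OaRC before (OaRC N)) :
  (regret N (OaRC N) * (N%:R^-1)%:E)%E @[N --> \oo] --> (0 : \bar R)
  /\
  (forall N : nat, (1 <= N)%N ->
    (regret N (OaRC N) <=
      (cost_max M * U (nlevels M) (theta M) N * Num.sqrt N%:R)%:E)%E).
Proof.
have bounds N (N0 : (0 < N)%N) := oarc_regret_bounds N hg hbefore (hOaRC N N0).
split=> [|N N0]; last first.
  have /andP[_ /le_trans] := bounds N N0; apply.
  by rewrite lee_fin ler_wpM2r ?sqrtr_ge0// regret_factor_le_U.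
apply: squeeze_cvge (@cvg_cst _ (0 : \bar R)%E _ _ _)
  (cvg_sqrt_mean (regret_factor M)).
near=> N; have N0 : (0 < N)%N by near: N; exact: nbhs_infty_gt.
have /andP[regret_ge0 regret_le] := bounds N N0.
have NV : (0 <= (N%:R^-1)%:E :> \bar R)%E by rewrite lee_fin invr_ge0.
by rewrite mule_ge0//= EFinM lee_wpmul2r.
Unshelve. all: by end_near.
Qed.
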